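(* Let $N$ be the size of the ID space and let $2 \le n \le N-1$. Let $\mathcal{A}$ be a deterministic leader election algorithm in the $\mathsf{Receiver}\text{-}\mathsf{CD}$ model that is correct for every set of devices $V \subseteq [N]$ with $|V| = n$, and let $k$ be its energy complexity. Then $k \geq \Omega(\log \frac{N}{n})$.
   Context: Single-hop radio network: a set $V$ of devices, each device $v$ having a distinct identifier $\mathsf{ID}(v) \in [N] = \{1,\dots,N\}$; $N$ and $n$ are known to all devices. Communication proceeds in synchronous time slots; in each slot each device (based on its ID, the known parameters and all feedback received so far) either stays idle, listens, or transmits a message. In the $\mathsf{Receiver}\text{-}\mathsf{CD}$ model, transmitters (and idle devices) receive no feedback; listeners receive silence if zero devices transmit, collision if at least two devices transmit, and the message if exactly one device transmits. Leader election: at termination exactly one device identifies itself as leader and all others as non-leaders. The energy complexity is the worst-case maximum over all devices of the number of time slots in which the device listens or transmits. *)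

(* Defs.v *)
From mathcomp Require Import all_boot all_order all_algebra.
From mathcomp Require Import reals exp.

Set Implicit Arguments.
Unset Strict Implicit.
Unset Printing Implicit Defensive.

Inductive status := Leader | NonLeader.

Inductive action (Msg : Type) := Idle | Listen | Transmit of Msg.

Inductive feedback (Msg : Type) :=
  NoFeedback | Silence | Collision | Received of Msg.

Arguments Idle {Msg}.
Arguments Listen {Msg}.
Arguments NoFeedback {Msg}.
Arguments Silence {Msg}.
Arguments Collision {Msg}.

Inductive decision (Msg : Type) := Act of action Msg | Halt of status.

Arguments Halt {Msg} _.

(* The ID space [N] is 'I_N (IDs shifted to 0, ..., N-1).  The list holds one
   feedback per elapsed slot, oldest first, so its size is the current time and
   the device can recompute its own past actions from it.  The dependence on
   the known parameters N and n is left implicit: an algorithm is fixed for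
   each pair (N, n). *)
Definition algorithm (N : nat) (Msg : Type) :=
  'I_N -> seq (feedback Msg) -> decision Msg.

Inductive state (Msg : Type) :=
  Running of seq (feedback Msg) | Terminated of status.

Arguments Terminated {Msg} _.

Section Execution.
Variables (N : nat) (Msg : Type) (A : algorithm N Msg).

Definition action_of (v : 'I_N) (s : state Msg) : action Msg :=
  if s is Running h then if A v h is Act a then a else Idle else Idle.

Definition sent (a : action Msg) : option Msg :=
  if a is Transmit m then Some m else None.

Definition is_awake (a : action Msg) : bool :=
  if a is Idle then false else true.

(* What a listener hears in the Receiver-CD model, given all messages
   transmitted in the slot. *)
Definition channel (ms : seq Msg) : feedback Msg :=
  match ms with
  | [::] => Silence
  | [:: m] => Received m
  | _ => Collision
  end.

Definition feedback_of (a : action Msg) (ms : seq Msg) : feedback Msg :=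
  if a is Listen then channel ms else NoFeedback.

Definition next_state (v : 'I_N) (s : state Msg) (ms : seq Msg) : state Msg :=
  match s with
  | Running h =>
      match A v h with
      | Act a => Running (rcons h (feedback_of a ms))
      | Halt r => Terminated r
      end
  | Terminated r => Terminated r
  end.

Variable V : {set 'I_N}.

Definition transmissions (c : 'I_N -> state Msg) : seq Msg :=
  pmap (fun v => sent (action_of v (c v))) (enum V).

(* State of each device after t slots when the set of devices present is V.
   The value is meaningful only at IDs in V; the others never transmit, since
   [transmissions] ranges over V only. *)
Fixpoint exec (t : nat) : 'I_N -> state Msg :=
  if t is t'.+1 then
    let c := exec t' in fun v => next_state v (c v) (transmissions c)
  else fun=> Running [::].

Definition elects_leader : Prop :=
  exists T : nat, exists2 l : 'I_N, l \in V &
    exec T l = Terminated Leader /\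
    forall v, v \in V -> v != l -> exec T v = Terminated NonLeader.

Definition energy (v : 'I_N) (T : nat) : nat :=
  \sum_(t < T) is_awake (action_of v (exec t v)).

End Execution.

Definition correct_leader_election (N n : nat) (Msg : Type)
    (A : algorithm N Msg) : Prop :=
  forall V : {set 'I_N}, #|V| = n -> elects_leader A V.

(* k is the maximum, over all device sets V of size n, all devices in V and all
   durations T, of the energy spent in the first T slots.  For a fixed device
   the energy is nondecreasing in T and constant once it has terminated. *)
Definition is_energy_complexity (N n : nat) (Msg : Type)
    (A : algorithm N Msg) (k : nat) : Prop :=
  (forall (V : {set 'I_N}) (v : 'I_N) (T : nat),
     #|V| = n -> v \in V -> energy A V v T <= k) /\
  (exists (V : {set 'I_N}) (v : 'I_N) (T : nat),
     [/\ #|V| = n, v \in V & energy A V v T = k]).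

(* Main.v *)
(** Follow every device on the assumption that it only ever hears silence.  If
    in each slot the devices of a set [V] do not both listen and transmit, then
    the real execution on [V] is this silent one, so the decision of a device
    of [V] does not depend on [V].  Permit in each slot either only listening
    or only transmitting, at random: a given device obeys in its first [k]
    awake slots, the only ones its energy allows it to reach, with probability
    at least [2 ^- k], so some choice is obeyed by at least [N / 2 ^ k] devices.
    If this exceeded [n], all the [n]-subsets of a set of more than [n >= 2]
    devices would contain exactly one of its would-be leaders, which is
    impossible.  Hence [N <= n * 2 ^ k]. *)

Require Import Defs.
From mathcomp Require Import all_boot all_order all_algebra.
From mathcomp Require Import reals exp.
From mathcomp Require Import zify.

Set Implicit Arguments.
Unset Strict Implicit.
Unset Printing Implicit Defensive.

Import Order.TTheory GRing.Theory Num.Theory.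
Local Open Scope ring_scope.

Lemma exists_subset_between (T : finType) (A B : {set T}) (n : nat) :
  A \subset B -> (#|A| <= n <= #|B|)%N ->
  exists C : {set T}, [/\ A \subset C, C \subset B & #|C| = n].
Proof.
move=> sAB /andP[leAn lenB].
have : (n - #|A| <= #|B :\: A|)%N by rewrite cardsDS // leq_sub2r.
case/card_geqP => s [uniq_s size_s sub_s].
have disj : A :&: [set x in s] = set0.
  apply/setP => x; rewrite !inE; apply/negP => /andP[xA /sub_s].
  by rewrite inE xA.
exists (A :|: [set x in s]); split.
- exact: subsetUl.
- rewrite subUset sAB; apply/subsetP => x; rewrite inE => /sub_s.
  by case/setDP.
- by rewrite cardsU disj cards0 subn0 cardsE (card_uniqP uniq_s) size_s subnKC.
Qed.

(** One [n]-subset yields a member [l] of [P], an [n]-subset avoiding [l] (possible as [n < #|S|])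
    yields a second one [l'], and an [n]-subset through both (possible as [2 <= n]) has two. *)
Lemma no_unique_member_in_every_subset (T : finType) (S : {set T})
    (P : T -> Prop) (n : nat) :
  (2 <= n < #|S|)%N ->
  ~ (forall V : {set T}, V \subset S -> #|V| = n ->
       exists2 l, l \in V & P l /\ forall v, v \in V -> v != l -> ~ P v).
Proof.
move=> /andP[n_ge2 ltnS] trans.
have [V0 [_ sV0S cV0]] : exists C : {set T},
    [/\ set0 \subset C, C \subset S & #|C| = n].
  apply: exists_subset_between; first exact: sub0set.
  by rewrite cards0 leq0n ltnW.
have [l lV0 [Pl _]] := trans _ sV0S cV0.
have lS := subsetP sV0S _ lV0.
have [V1 [_ sV1S cV1]] : exists C : {set T},
    [/\ set0 \subset C, C \subset S :\ l & #|C| = n].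
  apply: exists_subset_between; first exact: sub0set.
  rewrite cards0 leq0n /=.
  by rewrite (cardsD1 l) lS in ltnS.
have [l' l'V1 [Pl' _]] := trans _ (subset_trans sV1S (subsetDl _ _)) cV1.
have /setD1P[l'l l'S] := subsetP sV1S _ l'V1.
have [V2 [sllV2 sV2S cV2]] : exists C : {set T},
    [/\ [set l; l'] \subset C, C \subset S & #|C| = n].
  apply: exists_subset_between; first by rewrite subUset !sub1set lS.
  by rewrite cards2 eq_sym l'l n_ge2 (ltnW ltnS).
have [m _ [_ uniq_m]] := trans _ sV2S cV2.
have lV2 : l \in V2 by rewrite (subsetP sllV2) // set21.
have l'V2 : l' \in V2 by rewrite (subsetP sllV2) // set22.
have [lm|lm] := eqVneq l m; last exact: uniq_m lV2 lm Pl.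
by apply: uniq_m l'V2 _ Pl'; rewrite -lm.
Qed.

(* Derandomization: an element of [S] weighs [2] to the number of its active
   slots so far, capped at [k]; of the two choices for the next slot, one does
   not decrease the total weight. *)
Lemma exists_consistent_set (I : finType) (a : I -> nat -> option bool)
    (k T : nat) :
  exists S : {set I}, (#|I| <= #|S| * 2 ^ k)%N /\
    forall t, (t < T)%N -> exists b, forall v, v \in S ->
      (\sum_(s < t.+1) a v s <= k)%N -> a v t != Some (~~ b).
Proof.
pose e v t := (\sum_(s < t) a v s)%N.
suff [S [wS consS]] : exists S : {set I},
    (#|I| <= \sum_(v in S) 2 ^ minn k (e v T))%N /\
    forall t, (t < T)%N -> exists b, forall v, v \in S ->
      (e v t.+1 <= k)%N -> a v t != Some (~~ b).
  exists S; split=> //; apply: leq_trans wS _.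
  rewrite -sum_nat_const; apply: leq_sum => v _.
  by rewrite leq_exp2l // geq_minl.
elim: T => [|T [S [wS consS]]].
  exists setT; split=> //; rewrite -sum1_card.
  rewrite [X in (_ <= X)%N](eq_bigl predT) => [|v]; last by rewrite inE.
  by apply: leq_sum => v _; rewrite expn_gt0.
pose ok b v := ((e v T.+1 <= k) ==> (a v T != Some (~~ b)))%N.
pose S' b := [set v in S | ok b v].
pose w b := (\sum_(v in S' b) 2 ^ minn k (e v T.+1))%N.
have wE b : w b = (\sum_(v in S) ok b v * 2 ^ minn k (e v T.+1))%N.
  rewrite /w (eq_bigl (fun v => (v \in S) && ok b v)) => [|v].
    rewrite big_mkcondr; apply: eq_bigr => v _.
    by case: (ok b v); rewrite ?mul1n ?mul0n.
  by rewrite inE.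
have w2 : (2 * #|I| <= w true + w false)%N.
  rewrite !wE -big_split /=.
  apply: leq_trans (_ : (2 * \sum_(v in S) 2 ^ minn k (e v T) <= _)%N).
    by rewrite leq_mul2l.
  rewrite big_distrr; apply: leq_sum => v _ /=.
  have eS : e v T.+1 = (e v T + a v T)%N by rewrite /e big_ord_recr.
  (* Within the cap, an active [v] survives one choice with doubled weight, and an idle [v] survives
     both with its weight unchanged. Past the cap, [v] survives both. *)
  rewrite /ok; have [le_ek|lt_ke] /= := leqP (e v T.+1) k.
    rewrite eS in le_ek; rewrite eS.
    rewrite (minn_idPr (leq_trans (leq_addr _ _) le_ek)).
    case: (a v T) => [[]|] /=; rewrite ?addn1 ?addn0 ?expnS ?mul1n ?mul0n //.
    by rewrite addnn mul2n.
  by rewrite !mul1n addnn -mul2n leq_mul2l leq_exp2l // geq_minl.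
have [b wb] : exists b, (#|I| <= w b)%N.
  have [?|?] := leqP #|I| (w true); first by exists true.
  by exists false; lia.
exists (S' b); split=> // t; rewrite ltnS leq_eqVlt => /predU1P[->|/consS].
  by exists b => v; rewrite inE => /andP[_ /implyP].
by case=> b' cons'; exists b' => v; rewrite inE => /andP[/cons'].
Qed.

Section SilentExecution.
Variables (N : nat) (Msg : Type) (A : algorithm N Msg).

Definition silent_exec (v : 'I_N) (t : nat) : state Msg :=
  iter t (fun s => next_state A v s [::]) (Running [::]).

Definition silent_action (v : 'I_N) (t : nat) : action Msg :=
  action_of A v (silent_exec v t).

(* [Some true] for a transmission, [Some false] for listening; the coercion
   [option >-> bool] then agrees with [is_awake]. *)
Definition mode (a : action Msg) : option bool :=
  match a with
  | Idle => None
  | Listen => Some false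
  | Transmit _ => Some true
  end.

Lemma isSome_mode (a : action Msg) : (mode a : bool) = is_awake a.
Proof. by case: a. Qed.

Lemma next_state_silent (v : 'I_N) (s : state Msg) (ms : seq Msg) :
  (mode (action_of A v s) = Some false -> ms = [::]) ->
  next_state A v s ms = next_state A v s [::].
Proof. by case: s => //= h; case: (A v h) => //= -[] //= ->. Qed.

Lemma transmissions_nil (V : {set 'I_N}) (c : 'I_N -> state Msg) :
  (forall u, u \in V -> mode (action_of A u (c u)) != Some true) ->
  transmissions A V c = [::].
Proof.
move=> quiet; rewrite /transmissions.
have {quiet} : forall u, u \in enum V ->
    mode (action_of A u (c u)) != Some true.
  by move=> u; rewrite mem_enum; apply: quiet.
elim: (enum V) => //= u s IHs quiet.
have := quiet u (mem_head _ _); case: action_of => //= _;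
  by apply: IHs => x xs; apply: quiet; rewrite inE xs orbT.
Qed.

(** A listener still within its budget forces [b = false], so no device of [V] transmits in that
    slot and silence is what it hears. *)
Lemma exec_silent (V : {set 'I_N}) (k T : nat) :
  (forall v t, v \in V -> (energy A V v t <= k)%N) ->
  (forall t, (t < T)%N -> exists b, forall v, v \in V ->
     (\sum_(s < t.+1) mode (silent_action v s) <= k)%N ->
     mode (silent_action v t) != Some (~~ b)) ->
  forall t, (t <= T)%N -> forall v, v \in V -> exec A V t v = silent_exec v t.
Proof.
move=> energy_le cons t.
(* Strong induction: agreement in all earlier slots carries the energy bound over to the silent
   execution, as [cons] requires. *)
elim/ltn_ind: t => -[//|t] IH ltT v vV.
have agree s u : (s <= t)%N -> u \in V -> exec A V s u = silent_exec u s.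
  by move=> le_st uV; apply: IH => //; exact: leq_trans le_st (ltnW ltT).
have within u : u \in V ->
    (\sum_(s < t.+1) mode (silent_action u s) <= k)%N.
  move=> uV; apply: leq_trans (energy_le u t.+1 uV).
  apply: leq_sum => s _; rewrite isSome_mode agree //.
  by rewrite -ltnS.
have [b consb] := cons t ltT.
rewrite /= agree //; apply: next_state_silent => listen.
apply: transmissions_nil => u uV; rewrite agree //.
have := consb v vV (within v vV); have := consb u uV (within u uV).
by rewrite /silent_action listen; case: b {consb}.
Qed.

Lemma exec_terminated (V : {set 'I_N}) (v : 'I_N) (r : status) (t t' : nat) :
  (t <= t')%N -> exec A V t v = Terminated r -> exec A V t' v = Terminated r.
Proof.
move=> /subnK <-; elim: (t' - t)%N => [//|d IHd] /IHd.
by rewrite addSn /= => ->.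
Qed.

End SilentExecution.

Lemma id_space_bound (N n : nat) (Msg : Type) (A : algorithm N Msg) (k : nat) :
  (2 <= n)%N -> correct_leader_election n A ->
  (forall (V : {set 'I_N}) v t, #|V| = n -> v \in V -> energy A V v t <= k)%N ->
  (N <= n * 2 ^ k)%N.
Proof.
move=> n_ge2 correct energy_le.
pose elected (V : {set 'I_N}) T := exists2 l, l \in V &
  exec A V T l = Terminated Leader /\
  forall v, v \in V -> v != l -> exec A V T v = Terminated NonLeader.
have [Tf TfP] : exists Tf : {set 'I_N} -> nat,
    forall V : {set 'I_N}, #|V| = n -> elected V (Tf V).
  apply: (@fin_all_exists _ (fun=> nat)
    (fun (V : {set 'I_N}) T => #|V| = n -> elected V T)).
  move=> V; have [cV|nV] := eqVneq #|V| n.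
    by have [T elT] := correct V cV; exists T.
  by exists 0%N => cV; rewrite cV eqxx in nV.
(* The horizon must be fixed before [S], hence before [V]: a common time by which every election on
   [n] devices is over. *)
pose T := (\max_V Tf V)%N.
have [S [cS consS]] :=
  exists_consistent_set (fun v t => mode (silent_action A v t)) k T.
rewrite leqNgt; apply/negP => ltN.
have ltnS : (n < #|S|)%N.
  by rewrite -(ltn_pmul2r (expn_gt0 2 k)) (leq_trans ltN) // -{1}(card_ord N).
apply: (@no_unique_member_in_every_subset _ S
  (fun v => silent_exec A v T = Terminated Leader) n).
  by rewrite n_ge2.
move=> V sVS cV.
have silent v : v \in V -> exec A V T v = silent_exec A v T.
  apply: (@exec_silent _ _ A V k T) => // [u t uV|t ltT].
    exact: energy_le.
  have [b consb] := consS t ltT; exists b => u uV.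
  exact/consb/(subsetP sVS).
have leT : (Tf V <= T)%N by exact: leq_bigmax.
have [l lV [l_leader others]] := TfP V cV.
exists l => //; split=> [|v vV vl].
  by rewrite -silent //; exact: exec_terminated leT l_leader.
by rewrite -silent // (exec_terminated leT (others v vV vl)).
Qed.

Theorem theorem4p1 (R : realType) :
  exists c : R, 0 < c /\
    forall (N n : nat) (Msg : Type) (A : algorithm N Msg) (k : nat),
      (2 <= n)%N -> (n <= N - 1)%N ->
      correct_leader_election n A ->
      is_energy_complexity n A k ->
      c * ln (N%:R / n%:R) <= k%:R.
Proof.
have ln2_gt0 : 0 < ln (2 : R) by rewrite ln_gt0 // ltr1n.
(* This constant turns [ln] into the binary logarithm, so the claim becomes [N <= n * 2 ^ k]. *)
exists (ln 2)^-1; split; first by rewrite invr_gt0.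
move=> N n Msg A k n_ge2 le_nN correct [energy_le _].
have n_gt0 : 0 < n%:R :> R by rewrite ltr0n ltnW.
have N_gt0 : 0 < N%:R :> R by rewrite ltr0n; lia.
rewrite mulrC ler_pdivrMr // (mulr_natl (ln 2)) -lnXn ?ltr0n //.
rewrite ler_ln ?posrE ?divr_gt0 ?exprn_gt0 //.
rewrite ler_pdivrMr // -natrX -natrM ler_nat mulnC.
exact: id_space_bound correct energy_le.
Qed.
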